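(* The asymptotic completion of a rectifying Möbius strip has at least three singular points other than cuspidal edge singularities.
   Context: Let $\gamma:\mathbb{R}\to\mathbb{R}^3$ be a $C^\infty$ regular curve which is $l$-periodic ($\gamma(s+l)=\gamma(s)$, $\gamma'(s)\neq 0$), and let $\xi$ be a $C^\infty$ vector field along $\gamma$ which is $l$-odd-periodic ($\xi(s+l)=-\xi(s)$), with $\gamma'(s)$ and $\xi(s)$ linearly independent for every $s$. The immersion $F(s,u)=\gamma(s)+u\xi(s)$ ($s\in\mathbb{R}$, $|u|<\epsilon$, $\epsilon>0$ small) is called a ruled Möbius strip with generating curve $\gamma$ and ruling vector field $\xi$; it is called developable if it is flat, i.e. $\det(\gamma',\xi,\xi')\equiv 0$. A rectifying Möbius strip is a developable Möbius strip which contains a closed geodesic (the generating curve $\gamma$ is a geodesic of the strip, i.e. with $s$ arc-length, $\gamma''(s)\cdot\xi(s)=0$). The asymptotic completion (a-completion) of $F$ is the $C^\infty$ map $\tilde F(s,u)=\gamma(s)+u\xi(s)$ defined for all $(s,u)\in\mathbb{R}^2$ (regarded on the quotient identifying $(s,u)$ with $(s+l,-u)$). A singular point is a point where the Jacobi matrix has rank less than $2$. A cuspidal edge is a map germ right-left equivalent (i.e. equal after diffeomorphic changes of coordinates in source and target) to $f_C(u,v)=(2u^3,-3u^2,v)$ at the origin. *)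

(* Defs.v *)
From HB Require Import structures.
From mathcomp Require Import all_boot all_order all_algebra.
From mathcomp Require Import all_classical all_reals all_analysis.
Set Implicit Arguments. Unset Strict Implicit. Unset Printing Implicit Defensive.
Import Order.TTheory GRing.Theory Num.Theory.
Import numFieldNormedType.Exports.
Local Open Scope classical_set_scope.
Local Open Scope ring_scope.

Section Defs.
Variable R : realType.

Fixpoint iterD {U V : normedModType R} (vs : seq U) (f : U -> V) : U -> V :=
  if vs is v :: vs' then derive (iterD vs' f) ^~ v else f.

Definition smooth_on {U V : normedModType R} (A : set U) (f : U -> V) : Prop :=
  open A /\
  forall (vs : seq U) (x : U), A x ->
    {for x, continuous (iterD vs f)} /\ forall v : U, derivable (iterD vs f) x v.

Definition smooth {U V : normedModType R} (f : U -> V) := smooth_on setT f.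

Definition diffeo_on {n : nat} (A B : set 'rV[R]_n) (phi : 'rV[R]_n -> 'rV[R]_n) :=
  smooth_on A phi /\ open B /\
  exists psi : 'rV[R]_n -> 'rV[R]_n,
    smooth_on B psi /\
    (forall x, A x -> B (phi x) /\ psi (phi x) = x) /\
    (forall y, B y -> A (psi y) /\ phi (psi y) = y).

Definition vec2 (a b : R) : 'rV[R]_2 :=
  \row_(i < 2) (if (i : nat) == 0%N then a else b).
Definition vec3 (a b c : R) : 'rV[R]_3 :=
  \row_(i < 3) (if (i : nat) == 0%N then a else if (i : nat) == 1%N then b else c).

Definition dotv (u v : 'rV[R]_3) : R := (u *m v^T) 0 0.
Definition det3 (a b c : 'rV[R]_3) : R :=
  \det (\matrix_(i < 3, j < 3)
          (if (i : nat) == 0%N then a 0 j else if (i : nat) == 1%N then b 0 j else c 0 j)).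

Definition dcurve (g : R -> 'rV[R]_3) : R -> 'rV[R]_3 := derive1 g.

Definition ruled_moebius (l : R) (gamma xi : R -> 'rV[R]_3) : Prop :=
  0 < l /\ smooth gamma /\ smooth xi /\
  (forall s, gamma (s + l) = gamma s) /\
  (forall s, dcurve gamma s != 0) /\
  (forall s, xi (s + l) = - xi s) /\
  (forall s (a b : R), a *: dcurve gamma s + b *: xi s = 0 -> a = 0 /\ b = 0).

Definition developable_moebius (l : R) (gamma xi : R -> 'rV[R]_3) : Prop :=
  ruled_moebius l gamma xi /\
  forall s, det3 (dcurve gamma s) (xi s) (dcurve xi s) = 0.

(* rectifying: developable, and the generating curve (parametrized by
   arc length) is a geodesic of the strip: gamma'' . xi = 0 *)
Definition rectifying_moebius (l : R) (gamma xi : R -> 'rV[R]_3) : Prop :=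
  developable_moebius l gamma xi /\
  (forall s, dotv (dcurve gamma s) (dcurve gamma s) = 1) /\
  (forall s, dotv (dcurve (dcurve gamma) s) (xi s) = 0).

Definition a_completion (gamma xi : R -> 'rV[R]_3) (p : 'rV[R]_2) : 'rV[R]_3 :=
  gamma (p 0 0) + (p 0 1) *: xi (p 0 0).

Definition moebius_equiv (l : R) (p q : 'rV[R]_2) : Prop :=
  exists k : int,
    q 0 0 = p 0 0 + k%:~R * l /\ q 0 1 = (-1) ^+ `|k|%N * p 0 1.

Definition jacobi (f : 'rV[R]_2 -> 'rV[R]_3) (p : 'rV[R]_2) : 'M[R]_(2, 3) :=
  \matrix_(i < 2) ('D_(delta_mx 0 i : 'rV[R]_2) f p).

Definition singular_point (f : 'rV[R]_2 -> 'rV[R]_3) (p : 'rV[R]_2) : Prop :=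
  (\rank (jacobi f p) < 2)%N.

Definition f_C (x : 'rV[R]_2) : 'rV[R]_3 :=
  vec3 (2 * x 0 0 ^+ 3) (- (3 * x 0 0 ^+ 2)) (x 0 1).

(* the germ of f at p is right-left equivalent to the germ of f_C at 0 *)
Definition cuspidal_edge_at (f : 'rV[R]_2 -> 'rV[R]_3) (p : 'rV[R]_2) : Prop :=
  exists (U V : set 'rV[R]_2) (W W' : set 'rV[R]_3)
         (phi : 'rV[R]_2 -> 'rV[R]_2) (Phi : 'rV[R]_3 -> 'rV[R]_3),
    diffeo_on U V phi /\ U 0 /\ phi 0 = p /\
    diffeo_on W W' Phi /\ W (f p) /\ Phi (f p) = 0 /\
    forall x, U x -> W (f (phi x)) /\ Phi (f (phi x)) = f_C x.

End Defs.

(* Main.v *)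
Require Import Defs.
From HB Require Import structures.
From mathcomp Require Import all_boot all_order all_algebra.
From mathcomp Require Import ring lra zify.
From mathcomp Require Import all_classical all_reals all_analysis.
Set Implicit Arguments. Unset Strict Implicit. Unset Printing Implicit Defensive.
Import Order.TTheory GRing.Theory Num.Theory.
Import numFieldNormedType.Exports.
Local Open Scope classical_set_scope.
Local Open Scope ring_scope.

(** Rescale the ruling field to [D = beta xi], whose component orthogonal to
    [e = gamma'] is a unit vector.  With [c = D . e] one has [|D|^2 = 1 + c^2],
    and flatness together with the geodesic equation gives [D' = c' e].  Hence the
    singular points are the [(s, - beta s / c' s)] with [c' s <> 0]; along them
    [F = gamma - D / c'] has derivative [c'' D / c'^2], so that a zero of [c''] with
    [c' <> 0] is not a cuspidal edge: the singular curve of a cuspidal edge has an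
    immersed image.  Both [D] and [c] are [l]-antiperiodic.  If [c'] had a constant
    sign on a period from [s], the chord from [D s] to [- D s], of length
    [2 sqrt (1 + c^2)], would have length at most [2 |c s|].  So [c'] takes both
    signs on every open period; being antiperiodic it then has three zeros per
    period separated by points where it does not vanish, and the extrema
    between consecutive zeros are three critical points of [c'] with [c' <> 0]. *)

(** * Repeated differentiability of scalar functions and of the coordinates of curves *)

Section Ck.
Variable R : realType.
Implicit Types (f g : R -> R) (k : nat).

(** The derivatives of [f] up to order [k] exist everywhere; required for every [k], this is
    smoothness. *)
Fixpoint ck k f : Prop :=
  if k is k'.+1 then (forall x, derivable f x 1) /\ ck k' (derive1 f) else True.

Lemma ckS k f : ck k.+1 f -> ck k f.
Proof.
elim: k f => [//|k IH] f [df cf]; split => //; exact: IH.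
Qed.

Lemma is_derive_derive1 f (x a : R) : is_derive x (1 : R) f a -> derive1 f x = a.
Proof. by move=> H; rewrite derive1E; apply: derive_val. Qed.

Lemma is_derive1E f (df : R -> R) :
  (forall x : R, is_derive x (1 : R) f (df x)) -> derive1 f = df.
Proof. by move=> H; apply/funext => x; rewrite derive1E; apply: derive_val. Qed.

Lemma ck_is_derive k f x : ck k.+1 f -> is_derive x (1 : R) f (derive1 f x).
Proof. by case=> df _; rewrite derive1E; apply: derivableP. Qed.

Lemma ck_cst k (a : R) : ck k (cst a).
Proof.
elim: k a => [//|k IH] a; split => [x|]; first exact: derivable_cst.
by rewrite (_ : derive1 (cst a) = cst 0) //; apply: is_derive1E => x; exact: is_derive_cst.
Qed.

Lemma ckD k f g : ck k f -> ck k g -> ck k (fun x => f x + g x).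
Proof.
elim: k f g => [//|k IH] f g [df cf] [dg cg].
have D (x : R) : is_derive x (1 : R) (fun x => f x + g x) (derive1 f x + derive1 g x).
  rewrite !derive1E; exact: (is_deriveD (derivableP (df x)) (derivableP (dg x))).
split; first by move=> x; exact: (@ex_derive _ _ _ _ _ _ _ (D x)).
by rewrite (is_derive1E D); exact: IH.
Qed.

Lemma is_deriveM1 f g x a b : is_derive x (1 : R) f a -> is_derive x (1 : R) g b ->
  is_derive x (1 : R) (fun x => f x * g x) (a * g x + f x * b).
Proof.
move=> Df Dg; apply: (is_derive_eq (is_deriveM Df Dg)).
by rewrite /GRing.scale/= addrC mulrC.
Qed.

Lemma ckM k f g : ck k f -> ck k g -> ck k (fun x => f x * g x).
Proof.
elim: k f g => [//|k IH] f g cf cg.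
have D (x : R) : is_derive x (1 : R) (fun x => f x * g x) (derive1 f x * g x + f x * derive1 g x).
  by apply: is_deriveM1; [exact: ck_is_derive cf | exact: ck_is_derive cg].
split; first by move=> x; exact: (@ex_derive _ _ _ _ _ _ _ (D x)).
rewrite (is_derive1E D); apply: ckD; apply: IH.
- exact: cf.2.
- exact: ckS.
- exact: ckS.
- exact: cg.2.
Qed.

Lemma is_derive_rsqrt f x a : 0 < f x -> is_derive x (1 : R) f a ->
  is_derive x (1 : R) (fun x => (Num.sqrt (f x))^-1)
    (- 2^-1 * ((Num.sqrt (f x))^-1 * ((Num.sqrt (f x))^-1 * (Num.sqrt (f x))^-1)) * a).
Proof.
move=> f0 Df.
have s0 : Num.sqrt (f x) != 0 by rewrite gt_eqF// sqrtr_gt0.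
have D1 := is_derive1_comp (is_derive1_sqrt f0) Df.
apply: (is_derive_eq (@is_deriveV _ (fun x => Num.sqrt (f x)) x _ 1 s0 D1)).
by rewrite /GRing.scale/=; field.
Qed.

(** With [h] the inverse square root of [f], [h' = - h^3 f' / 2] is again a polynomial in [h] and
    [f'], so induction on [k] closes. *)
Lemma ck_rsqrt k f : (forall x, 0 < f x) -> ck k f ->
  ck k (fun x => (Num.sqrt (f x))^-1).
Proof.
move=> f0; elim: k => [//|k IH] cf.
have D (x : R) := is_derive_rsqrt (f0 x) (ck_is_derive x cf).
split; first by move=> x; exact: (@ex_derive _ _ _ _ _ _ _ (D x)).
have ch : ck k (fun x => (Num.sqrt (f x))^-1) by apply: IH; exact: ckS.
rewrite (is_derive1E D); apply: ckM; last exact: cf.2.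
by apply: ckM; [exact: ck_cst | apply: ckM => //; exact: ckM].
Qed.

Lemma smooth_ck n (g : R -> 'rV[R]_n) k i : smooth g -> ck k (fun t => g t 0 i).
Proof.
move=> [_ sg].
have der j t : derivable (Defs.iterD (nseq j (1 : R)) g) t 1.
  by case: (sg (nseq j (1 : R)) t I).
(* Generalizing to all iterated derivatives in direction 1 lets the induction on [k] pass from [j]
   to [j.+1]. *)
suff H j : ck k (fun t => Defs.iterD (nseq j (1 : R)) g t 0 i) by exact: (H 0%N).
elim: k j => [//|k IH] j; split.
  by move=> t; have /derivable_mxP := der j t; apply.
rewrite (_ : derive1 _ = (fun t => Defs.iterD (nseq j.+1 (1 : R)) g t 0 i)); first exact: IH.
apply/funext => t; rewrite derive1E /=.
by have := derive_mx (der j t) => /= ->; rewrite mxE.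
Qed.

Lemma derive1_coord n (g : R -> 'rV[R]_n) s i :
  (forall j, derivable (fun t => g t 0 j) s 1) ->
  derive1 g s 0 i = derive1 (fun t => g t 0 i) s.
Proof.
move=> dg; rewrite !derive1E derive_mx ?mxE//.
by apply/derivable_mxP => k j; rewrite ord1.
Qed.

Lemma dcurveE (g : R -> 'rV[R]_3) s i : smooth g ->
  dcurve g s 0 i = derive1 (fun t => g t 0 i) s.
Proof.
by move=> sg; rewrite /dcurve derive1_coord// => j; exact: (smooth_ck 1 j sg).1.
Qed.

End Ck.

(** * Scalar product and determinant in three-space *)

Section Dot.
Variable R : realType.
Implicit Types (u v w : 'rV[R]_3).

Lemma dotvE u v : dotv u v = \sum_i u 0 i * v 0 i.
Proof. by rewrite /dotv mxE; apply: eq_bigr => i _; rewrite mxE. Qed.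

Lemma dotvC u v : dotv u v = dotv v u.
Proof. by rewrite !dotvE; apply: eq_bigr => i _; rewrite mulrC. Qed.

Lemma dotvDl u v w : dotv (u + v) w = dotv u w + dotv v w.
Proof. by rewrite /dotv mulmxDl mxE. Qed.

Lemma dotvZl a u w : dotv (a *: u) w = a * dotv u w.
Proof. by rewrite /dotv -scalemxAl mxE. Qed.

Lemma dotvNl u w : dotv (- u) w = - dotv u w.
Proof. by rewrite -scaleN1r dotvZl mulN1r. Qed.

Lemma dotvDr u v w : dotv w (u + v) = dotv w u + dotv w v.
Proof. by rewrite dotvC dotvDl !(dotvC w). Qed.

Lemma dotvZr a u w : dotv w (a *: u) = a * dotv w u.
Proof. by rewrite dotvC dotvZl (dotvC w). Qed.

Lemma dotvNr u w : dotv w (- u) = - dotv w u.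
Proof. by rewrite dotvC dotvNl (dotvC w). Qed.

Lemma dotv_ge0 u : 0 <= dotv u u.
Proof. by rewrite dotvE; apply: sumr_ge0 => i _; rewrite -expr2 sqr_ge0. Qed.

Lemma dotv_eq0 u : (dotv u u == 0) = (u == 0).
Proof.
apply/eqP/eqP => [|->]; last by rewrite /dotv mul0mx mxE.
rewrite dotvE => /eqP; rewrite psumr_eq0 => [/allP H|i _]; last first.
  by rewrite -expr2 sqr_ge0.
apply/rowP => i; rewrite mxE.
by have := H i (mem_index_enum _); rewrite /= -expr2 sqrf_eq0 => /eqP.
Qed.

Lemma dotv3E u v : dotv u v = u 0 0 * v 0 0 + u 0 1 * v 0 1 + u 0 2 * v 0 2.
Proof.
rewrite dotvE !big_ord_recl big_ord0 addr0 addrA.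
by congr (_ * _ + _ * _ + _ * _); congr (_ _ _); apply: val_inj.
Qed.

Lemma det3E u v w : det3 u v w =
  u 0 0 * (v 0 1 * w 0 2 - v 0 2 * w 0 1)
  - u 0 1 * (v 0 0 * w 0 2 - v 0 2 * w 0 0)
  + u 0 2 * (v 0 0 * w 0 1 - v 0 1 * w 0 0).
Proof.
rewrite /det3 (expand_det_row _ 0) !big_ord_recl big_ord0 /cofactor.
rewrite !(expand_det_row _ 0) !big_ord_recl !big_ord0 /cofactor !det_mx11 !mxE /=.
have E1 : lift ord0 ord0 = 1 :> 'I_3 by apply: val_inj.
have E2 : lift ord0 (lift ord0 ord0) = 2 :> 'I_3 by apply: val_inj.
have E0 : ord0 = 0 :> 'I_3 by apply: val_inj.
have F1 : lift 1 (lift 0 0) = 2 :> 'I_3 by apply: val_inj.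
have F2 : lift 1 0 = 0 :> 'I_3 by apply: val_inj.
have F3 : lift 2 0 = 0 :> 'I_3 by apply: val_inj.
have F4 : lift 2 (lift 0 0) = 1 :> 'I_3 by apply: val_inj.
have F5 : lift 0 (lift (lift ord0 ord0) 0) = 1 :> 'I_3 by apply: val_inj.
have F6 : lift 1 (lift (lift ord0 ord0) 0) = 0 :> 'I_3 by apply: val_inj.
have F7 : lift 2 (lift (lift ord0 ord0) 0) = 0 :> 'I_3 by apply: val_inj.
rewrite ?E1 ?E2 ?E0 ?F1 ?F2 ?F3 ?F4 /=.
rewrite /bump /= !expr0 ?expr1 !addr0 ?add1n ?F5 ?F6 ?F7 add0n expr2; ring.
Qed.

(** The last hypothesis is the Gram determinant of [u], [v], nonzero when they are independent; [w]
    then lies in their plane and is orthogonal to it. *)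
Lemma det3_orth u v w : dotv u w = 0 -> dotv v w = 0 -> det3 u v w = 0 ->
  dotv u u * dotv v v - dotv u v ^+ 2 != 0 -> w = 0.
Proof.
move=> uw vw d0 n0; apply/eqP; rewrite -dotv_eq0; apply/eqP.
apply: (mulfI n0); rewrite mulr0.
(* the Gram determinant of u, v, w is the square of det3 u v w *)
have : det3 u v w ^+ 2 = dotv u u * dotv v v * dotv w w
    + 2 * dotv u v * dotv v w * dotv u w - dotv u u * dotv v w ^+ 2
    - dotv v v * dotv u w ^+ 2 - dotv w w * dotv u v ^+ 2.
  by rewrite det3E !dotv3E; ring.
by rewrite d0 uw vw => H; rewrite mulrBl; lra.
Qed.

Lemma det3Dr u v w w' : det3 u v (w + w') = det3 u v w + det3 u v w'.
Proof. by rewrite !det3E !mxE; ring. Qed.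

Lemma det3Zr a u v w : det3 u v (a *: w) = a * det3 u v w.
Proof. by rewrite !det3E !mxE; ring. Qed.

Lemma det3Zm a u v w : det3 u (a *: v) w = a * det3 u v w.
Proof. by rewrite !det3E !mxE; ring. Qed.

Lemma det3_eqlr u v : det3 u v u = 0.
Proof. by rewrite !det3E; ring. Qed.

Lemma det3_eqmr u v : det3 u v v = 0.
Proof. by rewrite !det3E; ring. Qed.

(** Cauchy-Schwarz, read off from the nonnegative squared length of [v - (u . v) u], which is
    [r^2 - (u . v)^2]. *)
Lemma dotv_unit_ge u v r : dotv u u = 1 -> dotv v v = r ^+ 2 -> 0 <= r -> - r <= dotv u v.
Proof.
move=> u1 vr r0; suff : dotv u v ^+ 2 <= r ^+ 2.
  by move=> H; rewrite leNgt; apply/negP => lt; nra.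
have := dotv_ge0 (v - dotv u v *: u).
rewrite dotvDl !dotvDr !dotvNl !dotvNr !dotvZl !dotvZr u1 vr (dotvC v u).
by move=> H; lra.
Qed.

Lemma dotv_is_derive (u v : R -> 'rV[R]_3) u' v' (s : R) :
  (forall i, is_derive s (1 : R) (fun t => u t 0 i) (u' 0 i)) ->
  (forall i, is_derive s (1 : R) (fun t => v t 0 i) (v' 0 i)) ->
  is_derive s (1 : R) (fun t => dotv (u t) (v t)) (dotv u' (v s) + dotv (u s) v').
Proof.
move=> Du Dv; rewrite !dotvE -big_split /=.
rewrite (_ : (fun t => _) = \sum_(i < 3) (fun t => u t 0 i * v t 0 i)).
  by apply: is_derive_sum => i; exact: is_deriveM1.
by apply/funext => t; rewrite dotvE fct_sumE.
Qed.

Lemma ck_dotv k (u v : R -> 'rV[R]_3) :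
  (forall i, ck k (fun t => u t 0 i)) -> (forall i, ck k (fun t => v t 0 i)) ->
  ck k (fun t => dotv (u t) (v t)).
Proof.
move=> cu cv; rewrite (_ : (fun t => _) =
  (fun t => u t 0 0 * v t 0 0 + u t 0 1 * v t 0 1 + u t 0 2 * v t 0 2)).
  by apply: ckD; [apply: ckD|]; apply: ckM.
by apply/funext => t; rewrite dotv3E.
Qed.
End Dot.

(** * The rescaled ruling field and its derivative *)

Section Frame.
Variables (R : realType) (l : R) (gamma xi : R -> 'rV[R]_3).

(** [beta] normalizes the part of [xi] orthogonal to [gamma'], and [c] is the component of
    [beta *: xi] along [gamma']. The derivative formula holds because the difference [w] of its two
    sides is both orthogonal to and coplanar with two independent vectors. *)
Lemma rectifying_frame : rectifying_moebius l gamma xi ->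
  exists beta c : R -> R,
    [/\ forall s, 0 < beta s, forall k, ck k beta, forall k, ck k c,
        forall s, beta (s + l) = beta s & forall s, c (s + l) = - c s] /\
    (forall s, dotv (beta s *: xi s) (beta s *: xi s) = 1 + c s ^+ 2) /\
    (forall s i, is_derive s (1 : R) (fun t => (beta t *: xi t) 0 i)
       (derive1 c s * dcurve gamma s 0 i)).
Proof.
move=> [[[l0 [sg [sx [pg [g0 [px lin]]]]]] dev] [unit geod]].
set e := dcurve gamma.
have cke k i : ck k (fun t => e t 0 i).
  rewrite (_ : (fun t => _) = derive1 (fun t => gamma t 0 i)).
    by have [_] := smooth_ck k.+1 i sg.
  by apply/funext => t; rewrite /e (dcurveE t i sg).
have ckx k i : ck k (fun t => xi t 0 i) by exact: smooth_ck.
have pe s : e (s + l) = e s.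
  apply/rowP => i; rewrite /e !(dcurveE _ i sg).
  have dg := @ck_is_derive _ 0 (fun t => gamma t 0 i) (s + l) (smooth_ck 1 i sg).
  have := @is_derive1_comp _ _ (shift l) s _ _ dg (is_derive_shift s (1 : R) l).
  rewrite (_ : _ \o _ = (fun t => gamma t 0 i)); last by apply/funext => t /=; rewrite pg.
  by rewrite mulr1 => /is_derive_derive1 ->.
pose a t := dotv (xi t) (e t).
(* [B] is the squared length of the part of [xi] orthogonal to [e], positive by linear
   independence. *)
pose B t := dotv (xi t) (xi t) - a t ^+ 2.
have BE t : B t = dotv (xi t - a t *: e t) (xi t - a t *: e t).
  rewrite dotvDl !dotvDr !dotvNl !dotvNr !dotvZl !dotvZr unit (dotvC (e t)).
  by rewrite /B /a; ring.
have B0 t : 0 < B t.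
  rewrite BE lt_def dotv_ge0 andbT dotv_eq0; apply/eqP => H.
  have : (- a t) *: e t + 1 *: xi t = 0 by rewrite scale1r scaleNr addrC.
  by move=> /lin [_ /eqP]; rewrite oner_eq0.
have cka k : ck k a by exact: ck_dotv.
have ckB k : ck k B.
  rewrite (_ : B = (fun t => dotv (xi t) (xi t) + (-1) * (a t * a t))).
    by apply: ckD; [exact: ck_dotv | apply: ckM; [exact: ck_cst | exact: ckM]].
  by apply/funext => t; rewrite /B; ring.
pose beta t := (Num.sqrt (B t))^-1.
have ckb k : ck k beta by exact: ck_rsqrt.
have beta0 t : 0 < beta t by rewrite invr_gt0 sqrtr_gt0.
have betaB t : beta t ^+ 2 * B t = 1.
  by rewrite /beta exprVn sqr_sqrtr ?ltW// mulVf// gt_eqF.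
pose c t := beta t * a t.
pose D t := beta t *: xi t.
have pa s : a (s + l) = - a s by rewrite /a px pe dotvNl.
have pb s : beta (s + l) = beta s by rewrite /beta /B pa px dotvNl dotvNr opprK sqrrN.
have DD s : dotv (D s) (D s) = 1 + c s ^+ 2.
  rewrite /D dotvZl dotvZr -(betaB s) /B /c; ring.
exists beta, c; split; [split => //|split => //].
- by move=> k; exact: ckM.
- by move=> s; rewrite /c pb pa mulrN.
move=> s i.
have ckD k j : ck k (fun t => D t 0 j).
  rewrite (_ : (fun t => _) = (fun t => beta t * xi t 0 j)); first exact: ckM.
  by apply/funext => t; rewrite mxE.
pose D' : 'rV[R]_3 := \row_j derive1 (fun t => D t 0 j) s.
pose e' := dcurve e s.
have dD j : is_derive s (1 : R) (fun t => D t 0 j) (D' 0 j).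
  by rewrite mxE; exact: (ck_is_derive s (ckD 1 j)).
have dx j : is_derive s (1 : R) (fun t => xi t 0 j) (dcurve xi s 0 j).
  by rewrite (dcurveE s j sx); exact: (ck_is_derive s (ckx 1 j)).
have db := ck_is_derive s (ckb 1%N).
have D'E : D' = derive1 beta s *: xi s + beta s *: dcurve xi s.
  apply/rowP => j; have Dp := is_deriveM1 db (dx j).
  have E : (fun t => D t 0 j) = (fun t => beta t * xi t 0 j).
    by apply/funext => t; rewrite mxE.
  rewrite [LHS]mxE E (is_derive_derive1 Dp) [RHS]mxE.
  by rewrite [X in _ = X + _]mxE [X in _ = _ + X]mxE.
have de j : is_derive s (1 : R) (fun t => e t 0 j) (e' 0 j).
  rewrite /e' derive1_coord; last by move=> k; exact: (cke 1%N k).1.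
  exact: (ck_is_derive s (cke 1%N j)).
set w := D' - derive1 c s *: e s.
have De t : dotv (D t) (e t) = c t by rewrite dotvZl.
have dc : is_derive s (1 : R) c (derive1 c s) := ck_is_derive s (ckM (ckb 1%N) (cka 1%N)).
have w0 : w = 0.
  apply: (@det3_orth _ (e s) (D s)).
  (* Differentiate [D . e = c]; the term [D . e'] vanishes by the geodesic equation. *)
  - have := dotv_is_derive dD de.
    rewrite (_ : (fun t => _) = c); last by apply/funext => t; rewrite De.
    rewrite dotvZl (dotvC (xi s)) geod mulr0 addr0 => /is_derive_derive1 H.
    by rewrite dotvDr dotvNr dotvZr unit mulr1 (dotvC (e s)) -H subrr.
  (* Differentiating [D . D = 1 + c^2] gives [D . D' = c c'], which equals [D . (c' e)]. *)
  - have := dotv_is_derive dD dD.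
    rewrite (_ : (fun t => _) = (fun t => 1 + c t * c t)); last first.
      by apply/funext => t; rewrite DD.
    have := is_deriveD (is_derive_cst (1 : R) s (1 : R)) (is_deriveM1 dc dc).
    move=> /is_derive_derive1 H1 /is_derive_derive1; rewrite H1 => H.
    rewrite dotvDr dotvNr dotvZr (De s); move: H; rewrite (dotvC D').
    by move: (dotv (D s) D') (derive1 c s) => X Y; lra.
  (* [D'] is a combination of [xi] and [xi'], so flatness makes it coplanar with [e] and [D]. *)
  - rewrite /w -scaleNr det3Dr det3Zr det3_eqlr mulr0 addr0 D'E det3Dr det3Zr.
    by rewrite det3Zm det3_eqmr det3Zr det3Zm dev !mulr0 addr0.
  (* The Gram determinant of [e] and [D] is [(1 + c^2) - c^2 = 1]. *)
  - by rewrite unit DD dotvC De mul1r addrK oner_eq0.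
have -> : derive1 c s * dcurve gamma s 0 i = D' 0 i; last exact: dD.
by move/eqP: w0; rewrite subr_eq0 => /eqP ->; rewrite mxE.
Qed.
End Frame.

(** * Zeros and critical points of antiperiodic functions *)

Section Critical.
Variable R : realType.
Implicit Types (f c : R -> R) (l : R).

Lemma derivable_continuous f : (forall x, derivable f x 1) -> continuous f.
Proof. by move=> df x; apply/differentiable_continuous/derivable1_diffP/df. Qed.

(** Up to the sign of [f], [f x] is positive; the maximum over [[a, b]] is then positive, hence
    attained in the interior. *)
Lemma critical_between_zeros f a b x : (forall t, derivable f t 1) ->
  f a = 0 -> f b = 0 -> a < x < b -> f x != 0 ->
  exists z, [/\ a < z < b, f z != 0 & is_derive z (1 : R) f 0].
Proof.
wlog fx : f / 0 < f x => [wlg|] df fa fb axb fx0.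
  move: (fx0); rewrite neq_lt => /orP[fx|fx]; last exact: wlg.
  have df' t : derivable (\- f) t 1 by exact/derivableN.
  have fa' : (\- f) a = 0 by rewrite /= fa oppr0.
  have fb' : (\- f) b = 0 by rewrite /= fb oppr0.
  have fx' : 0 < (\- f) x by rewrite /= oppr_gt0.
  have [z [azb fz dz]] := wlg _ fx' df' fa' fb' axb (lt0r_neq0 fx').
  exists z; split=> //; first by rewrite -oppr_eq0.
  by have := is_deriveN dz; rewrite oppr0 => H; rewrite -[f]opprK.
have /andP[ax xb] := axb; have ab := lt_trans ax xb.
have [m] := EVT_max (ltW ab) (continuous_subspaceT (derivable_continuous df)).
rewrite in_itv /= => /andP[am mb] maxm.
have fm : 0 < f m by apply: (lt_le_trans fx); apply: maxm; rewrite in_itv/= !ltW.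
have {}am : a < m by rewrite lt_def am andbT; apply: contraTneq fm => ->; rewrite fa ltxx.
have {}mb : m < b by rewrite lt_def mb andbT; apply: contraTneq fm => <-; rewrite fb ltxx.
exists m; split; rewrite ?am ?mb ?gt_eqF//.
apply: (derive1_at_max (ltW ab)) => //; first by rewrite in_itv/= am.
move=> t; rewrite in_itv /= => /andP[at_ tb]; apply: maxm.
by rewrite in_itv/= !ltW.
Qed.

Lemma zero_between f a b : continuous f -> a < b -> f a * f b < 0 ->
  exists2 z, a < z < b & f z = 0.
Proof.
move=> cf ab fab.
have [|z] := @IVT _ f a b 0 (ltW ab) (continuous_subspaceT cf).
  rewrite ge_min le_max; case: (lerP 0 (f a)) => fa.
    have fb : f b <= 0 by rewrite leNgt; apply/negP => fb; nra.
    by rewrite fb orbT.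
  have fb : 0 <= f b by rewrite leNgt; apply/negP => fb; nra.
  by rewrite ltW// fb orbT.
rewrite in_itv/= => /andP[az zb] fz; exists z => //.
rewrite !lt_def az zb !andbT; apply/andP; split.
  by apply: contraTneq fab => za; rewrite -za fz mul0r ltxx.
by apply: contraTneq fab => za; rewrite za fz mulr0 ltxx.
Qed.

(** Starting at a positive point [x1], let [E] collect the positive points of the closed period from
    [x1]. A positive point [y] within [l] beyond [sup E], shifted back by [l], is a negative point
    with points of [E] to its right. *)
Lemma antiperiodic_sign_changes f l : 0 < l -> (forall s, f (s + l) = - f s) ->
  (forall s, exists2 x, s < x < s + l & f x < 0) ->
  exists x1 x2 x3, [/\ x1 < x2, x2 < x3 & x3 < x1 + l] /\ [/\ 0 < f x1, f x2 < 0 & 0 < f x3].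
Proof.
move=> l0 fl neg.
have pos s : exists2 x, s < x < s + l & 0 < f x.
  have [x /andP[sx xs] fx] := neg (s + l); exists (x - l).
    by rewrite ltrBrDr sx ltrBlDr.
  by rewrite -oppr_lt0 -fl subrK.
have [x1 _ fx1] := pos 0.
have fx1l : f (x1 + l) < 0 by rewrite fl oppr_lt0.
pose E := [set x | x1 <= x <= x1 + l /\ 0 < f x].
have Ex1 : E x1 by split => //; rewrite lexx lerDl ltW.
have supE : has_sup E.
  by split; [exists x1 | exists (x1 + l) => x [/andP[]]].
have [y /andP[ty ytl] fy] := pos (sup E).
have tx1 : sup E <= x1 + l by apply: ge_sup => [|x [/andP[]]]; first by exists x1.
have x1y : x1 < y by apply: le_lt_trans ty; exact: sup_upper_bound.
(* Otherwise [y] would belong to [E] and lie beyond its supremum. *)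
have ly : x1 + l < y.
  rewrite ltNge; apply/negP => yl; move: ty; rewrite ltNge => /negP; apply.
  by apply: sup_upper_bound => //; split => //; rewrite ltW.
(* The tolerance [sup E - (y - l)] is positive and puts [x3] to the right of [y - l]. *)
have [|x3 [/andP[_ x3l] fx3] yx3] := @sup_adherent _ E (sup E - (y - l)) _ supE.
  by rewrite subr_gt0 ltrBlDr.
rewrite opprB addrC subrK in yx3.
exists x1, (y - l), x3; split; split => //.
- by rewrite ltrBrDr.
- by rewrite lt_def x3l andbT; apply: contraTneq fx3 => <-; rewrite -leNgt ltW.
- by rewrite -oppr_gt0 -fl subrK.
Qed.

(** The signs at [x1, x2, x3, x1 + l] alternate, giving zeros [z1 < z2 < z3 < z1 + l]. The three
    gaps contain [x2], [x3] and [x1 + l], so each has a critical point with nonzero value, and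
    [s3 < z1 + l < s1 + l]. *)
Lemma antiperiodic_three_critical f l : 0 < l -> (forall s, derivable f s 1) ->
  (forall s, f (s + l) = - f s) -> (forall s, exists2 x, s < x < s + l & f x < 0) ->
  exists s1 s2 s3, [/\ s1 < s2, s2 < s3 & s3 < s1 + l] /\
    forall s, s \in [:: s1; s2; s3] -> f s != 0 /\ is_derive s (1 : R) f 0.
Proof.
move=> l0 df fl neg; have cf := derivable_continuous df.
have [x1 [x2 [x3 [[x12 x23 x31] [f1 f2 f3]]]]] := antiperiodic_sign_changes l0 fl neg.
have f4 : f (x1 + l) < 0 by rewrite fl oppr_lt0.
have [z1 /andP[xz1 zx1] fz1] : exists2 z, x1 < z < x2 & f z = 0.
  by apply: zero_between => //; nra.
have [z2 /andP[xz2 zx2] fz2] : exists2 z, x2 < z < x3 & f z = 0.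
  by apply: zero_between => //; nra.
have [z3 /andP[xz3 zx3] fz3] : exists2 z, x3 < z < x1 + l & f z = 0.
  by apply: zero_between => //; nra.
have fz4 : f (z1 + l) = 0 by rewrite fl fz1 oppr0.
have [s1 [/andP[s1a s1b] n1 d1]] :
  exists z, [/\ z1 < z < z2, f z != 0 & is_derive z (1 : R) f 0].
  by apply: (@critical_between_zeros _ _ _ x2); rewrite ?zx1 ?xz2 ?lt_eqF.
have [s2 [/andP[s2a s2b] n2 d2]] :
  exists z, [/\ z2 < z < z3, f z != 0 & is_derive z (1 : R) f 0].
  by apply: (@critical_between_zeros _ _ _ x3); rewrite ?zx2 ?xz3 ?gt_eqF.
have [s3 [/andP[s3a s3b] n3 d3]] :
  exists z, [/\ z3 < z < z1 + l, f z != 0 & is_derive z (1 : R) f 0].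
  by apply: (@critical_between_zeros _ _ _ (x1 + l)); rewrite ?zx3 ?ltrD2r ?lt_eqF.
exists s1, s2, s3; split; first by split; lra.
by move=> s; rewrite !inE => /or3P[] /eqP ->.
Qed.

(** The chord argument, projected onto [v = D s]: were [c'] nonnegative on the period,
    [h = D . v + r c] with [r = |v|] could not decrease, since [h' = c' (e . v + r)] and
    [e . v >= - r]. *)
Lemma antiperiodic_ruling_neg (D e : R -> 'rV[R]_3) c l : 0 < l ->
  (forall s, derivable c s 1) ->
  (forall s, dotv (e s) (e s) = 1) ->
  (forall s, dotv (D s) (D s) = 1 + c s ^+ 2) ->
  (forall s i, is_derive s (1 : R) (fun t => D t 0 i) (derive1 c s * e s 0 i)) ->
  (forall s, D (s + l) = - D s) -> (forall s, c (s + l) = - c s) ->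
  forall s, exists2 x, s < x < s + l & derive1 c x < 0.
Proof.
move=> l0 dc unit DD dD pD pc s; apply: contrapT => H.
have {}H x : s < x < s + l -> 0 <= derive1 c x.
  by move=> sx; rewrite leNgt; apply/negP => cx; apply: H; exists x.
pose v := D s; pose r := Num.sqrt (1 + c s ^+ 2).
have r2 : r ^+ 2 = 1 + c s ^+ 2 by rewrite sqr_sqrtr// addr_ge0// sqr_ge0.
have r0 : 0 < r by rewrite sqrtr_gt0 ltr_pwDl// sqr_ge0.
pose h t := dotv (D t) v + r * c t.
have dh x : is_derive x (1 : R) h (derive1 c x * (dotv (e x) v + r)).
  have D1 := @dotv_is_derive _ D (cst v) (derive1 c x *: e x) 0 x.
  have D2 := is_deriveM1 (is_derive_cst r x (1 : R)) (derivableP (dc x)).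
  apply: (is_derive_eq (is_deriveD (D1 _ _) D2)) => [i|i|].
  - by rewrite mxE; exact: dD.
  - by rewrite mxE; exact: is_derive_cst.
  - rewrite dotvZl /= {2}/dotv trmx0 mulmx0 mxE -derive1E /=; ring.
have ss : s < s + l by rewrite ltrDl.
have [|z] := MVT ss (fun x _ => dh x).
  apply/continuous_subspaceT => x; apply/differentiable_continuous/derivable1_diffP.
  exact: (@ex_derive _ _ _ _ _ _ _ (dh x)).
rewrite in_itv/= => sz E.
have : 0 <= h (s + l) - h s.
  rewrite E (addrC s l) addrK; apply: mulr_ge0; last exact: ltW.
  apply: mulr_ge0; first exact: H.
  by have := @dotv_unit_ge _ (e z) v r (unit z); rewrite DD r2 => /(_ erefl (ltW r0)); lra.
(* The increment of [h] is [- 2 r (r + c s)], negative because [r^2 = 1 + (c s)^2] forces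
   [r > |c s|]. *)
rewrite /h pD pc dotvNl DD -r2; move: r2; move: (c s) => y; nra.
Qed.

End Critical.

(** * Pointwise Lipschitz bounds from directional derivatives *)

Section Calm.
Variable R : realType.

Lemma rV_norm_le n (v : 'rV[R]_n) (M : R) : 0 <= M -> (forall i, `|v 0 i| <= M) ->
  `|v| <= M.
Proof.
move=> M0 H; rewrite [leLHS]mx_normrE; apply: bigmax_le => // -[i j] _ /=.
by rewrite ord1.
Qed.

Lemma rV_coord_le n (v : 'rV[R]_n) i : `|v 0 i| <= `|v|.
Proof.
by rewrite [leRHS]mx_normrE; exact: (le_bigmax _ (fun ij => `|v ij.1 ij.2|) (0, i)).
Qed.

(** Both difference quotients coincide, so the one-variable mean value theorem becomes available for
    directional derivatives. *)
Lemma is_derive_line (V W : normedModType R) (f : V -> W) p v (t : R) :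
  derivable f (p + t *: v) v ->
  is_derive t (1 : R) (fun s => f (p + s *: v)) ('D_v f (p + t *: v)).
Proof.
have E : (fun h : R => h^-1 *:
      (((fun s => f (p + s *: v)) \o shift t) (h *: (1 : R)) - f (p + t *: v)))
   = (fun h => h^-1 *: ((f \o shift (p + t *: v)) (h *: v) - f (p + t *: v))).
  apply/funext => h /=; congr (_ *: (f _ - _)).
  by rewrite [h *: (1 : R)]mulr1 scalerDl addrCA.
by move=> df; apply: DeriveDef; rewrite /derivable /derive E.
Qed.

Lemma mean_value_bound (g dg : R -> R) (d M : R) :
  (forall t, `|t| <= `|d| -> is_derive t (1 : R) g (dg t) /\ `|dg t| <= M) ->
  `|g d - g 0| <= M * `|d|.
Proof.
move=> H.
have cg (a b : R) : (forall t, t \in `[a, b] -> `|t| <= `|d|) -> {within `[a, b], continuous g}.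
  move=> ab; apply: derivable_within_continuous => t /ab /H[dt _].
  exact: (@ex_derive _ _ _ _ _ _ _ dt).
have [d0|d0] := lerP 0 d.
  have D0 t : t \in `[0, d] -> `|t| <= `|d|.
    by rewrite in_itv/= => /andP[t0 td]; rewrite !ger0_norm.
  have [|t t0d ->] := @MVT_segment _ g dg _ _ d0 _ (cg _ _ D0).
    by move=> t /subset_itv_oo_cc /D0 /H[].
  by rewrite subr0 normrM ler_wpM2r// (H t (D0 _ t0d)).2.
have D0 t : t \in `[d, 0] -> `|t| <= `|d|.
  by rewrite in_itv/= => /andP[td t0]; rewrite !ler0_norm ?lerN2// ltW.
have [|t t0d E] := @MVT_segment _ g dg _ _ (ltW d0) _ (cg _ _ D0).
  by move=> t /subset_itv_oo_cc /D0 /H[].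
by rewrite distrC E sub0r normrM normrN ler_wpM2r// (H t (D0 _ t0d)).2.
Qed.

(* Calmness replaces the chain rule throughout: a C^1 map, given only through its
   directional derivatives, is pointwise Lipschitz, by the mean value theorem along
   a path parallel to the coordinate axes. *)
Lemma smooth_on_calm n m (A : set 'rV[R]_n) (f : 'rV[R]_n -> 'rV[R]_m) x :
  smooth_on A f -> A x ->
  exists2 L : R, 0 < L & \forall y \near x, `|f y - f x| <= L * `|y - x|.
Proof.
move=> [oA sA] Ax.
pose e i : 'rV[R]_n := delta_mx 0 i.
(* The added 1 makes [M] strictly larger than every partial derivative at [x], so the bound persists
   nearby by continuity. *)
pose M : R := 1 + \sum_i `|'D_(e i) f x|.
have M1 : 0 < M by rewrite ltr_pwDl// sumr_ge0.
have near_bound : \forall y \near x, A y /\ forall i, `|'D_(e i) f y| <= M.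
  near=> y; split; first by near: y; exact: open_nbhs_nbhs.
  near: y; apply: filter_forall => i.
  have [c _] := sA [:: e i] x Ax.
  apply: (cvgr_norm_le _ c) => /=.
  by rewrite /M (bigD1 i)//= addrCA ltrDl ltr_pwDl// sumr_ge0.
have [r /= r0 Hr] := (nbhs_normP x
  (fun y : 'rV[R]_n => A y /\ forall i, `|'D_(e i) f y| <= M)).1 near_bound.
(* The factor [n.+1] instead of [n] keeps the constant positive when [n] is 0. *)
exists (M *+ n.+1); first by rewrite pmulrn_lgt0.
near=> y.
have yr : `|y - x| < r.
  rewrite distrC; near: y.
  by have := nbhsx_ballx x r r0; rewrite -ball_normE.
(* The corners of an axis-parallel path from [p 0 = x] to [p n = y], changing one coordinate at a
   time. *)
pose p k : 'rV[R]_n := \row_i (if (i < k)%N then y 0 i else x 0 i).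
have step (k : 'I_n) : `|f (p k.+1) - f (p k)| <= M * `|y - x|.
  have -> : p k.+1 = p k + (y 0 k - x 0 k) *: e k.
    apply/rowP => i; rewrite !mxE eqxx /= ltnS leq_eqVlt.
    case: (ltngtP i k) => [ik|ki|/val_inj ->].
    - by rewrite (_ : (i == k) = false) ?mulr0 ?addr0//; apply/negbTE; rewrite -val_eqE ltn_eqF.
    - by rewrite (_ : (i == k) = false) ?mulr0 ?addr0//; apply/negbTE; rewrite -val_eqE gtn_eqF.
    - by rewrite eqxx mulr1 addrC subrK.
  set d := y 0 k - x 0 k.
  have dle : `|d| <= `|y - x| by have := rV_coord_le (y - x) k; rewrite !mxE.
  (* In the maximum norm the path stays in the ball, as no coordinate gets farther from [x] than
     [|y - x|]. *)
  have inb t : `|t| <= `|d| -> A (p k + t *: e k) /\ forall i, `|'D_(e i) f (p k + t *: e k)| <= M.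
    move=> td; apply: Hr => /=; apply: le_lt_trans yr.
    apply: rV_norm_le => // i; rewrite !mxE eqxx /=.
    have [->|ik] := eqVneq i k; first
      by rewrite ltnn mulr1 opprD addrA subrr sub0r normrN (le_trans td).
    rewrite mulr0 addr0; case: ifP => _; last by rewrite subrr normr0.
    by rewrite distrC; have := rV_coord_le (y - x) i; rewrite !mxE.
  apply: rV_norm_le => [|j]; first by rewrite mulr_ge0// ltW.
  rewrite !mxE -[in f (p k)](addr0 (p k)) -(scale0r (e k)).
  pose g t := f (p k + t *: e k) 0 j.
  apply: (@le_trans _ _ (M * `|d|)); last by rewrite ler_pM2l.
  apply: (@mean_value_bound g (fun t => 'D_(e k) f (p k + t *: e k) 0 j)) => t /inb[At Mt].
  split; last by apply: le_trans (Mt k); exact: rV_coord_le.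
  have [_ /(_ (e k)) dt] := sA [::] _ At.
  have D1 := is_derive_line dt.
  have dl : derivable (fun s : R => f (p k + s *: e k)) t (1 : R) := @ex_derive _ _ _ _ _ _ _ D1.
  have := derive_mx dl; rewrite (@derive_val _ _ _ _ _ _ _ D1) => ->.
  by rewrite mxE; apply: derivableP; have /derivable_mxP := dl; apply.
have path k : (k <= n)%N -> `|f (p k) - f (p 0%N)| <= M * `|y - x| *+ k.
  elim: k => [|k IH] kn; first by rewrite subrr normr0.
  rewrite mulrSr -(subrKA (f (p k))) (le_trans (ler_normD _ _))// addrC lerD//.
    by apply: IH; exact: ltnW.
  exact: (step (Ordinal kn)).
have pn : p n = y by apply/rowP => i; rewrite mxE ltn_ord.
have p0 : p 0%N = x by apply/rowP => i; rewrite mxE.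
have := path n (leqnn n); rewrite pn p0 => /le_trans; apply.
by rewrite mulrnAl ler_wpMn2l// mulr_ge0// ltW.
Unshelve. all: by end_near.
Qed.

End Calm.

(** * Metric obstructions to being a cuspidal edge *)

Section Cuspidal.
Variable R : realType.

(** Off the axis [u = 0], the last two coordinates [(-3 u^2, v)] suffice: the first of them varies
    by [3 |y - a| |y + a|], and [|y + a| >= |a|] once [|y - a| <= |a|]. *)
Lemma f_C_expansive (x : 'rV[R]_2) : x 0 0 != 0 ->
  exists2 k : R, 0 < k & \forall y \near x, k * `|y - x| <= `|f_C y - f_C x|.
Proof.
set a := x 0 0 => a0; exists (Num.min 1 (3 * `|a|)).
  by rewrite lt_min ltr01 mulr_gt0// normr_gt0.
near=> y.
have ya : `|y 0 0 - a| <= `|a|.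
  have -> : y 0 0 - a = (y - x) 0 0 by rewrite !mxE.
  apply: le_trans (rV_coord_le _ _) _; rewrite distrC ltW//; near: y.
  have a1 : 0 < `|a| by rewrite normr_gt0.
  by have := nbhsx_ballx x _ a1; rewrite -ball_normE.
have m0 : 0 < Num.min 1 (3 * `|a|) by rewrite lt_min ltr01 mulr_gt0// normr_gt0.
rewrite mulrC -ler_pdivlMr//; apply: rV_norm_le => [|i]; first by rewrite divr_ge0// ltW.
rewrite ler_pdivlMr//.
have [->|->] : i = 0 \/ i = 1.
  by case: i => -[|[|//]] H; [left|right]; apply: val_inj.
- apply: le_trans (rV_coord_le _ 1).
  rewrite !mxE /= -/a.
  have -> : - (3 * y 0 0 ^+ 2) - - (3 * a ^+ 2) = - ((y 0 0 - a) * (3 * (y 0 0 + a))) by ring.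
  rewrite normrN normrM ler_wpM2l// ge_min; apply/orP; right.
  rewrite normrM ger0_norm// ler_pM2l//.
  have -> : y 0 0 + a = a *+ 2 - (a - y 0 0) by ring.
  apply: le_trans (lerB_dist _ _); rewrite normrMn mulr2n distrC; lra.
- apply: le_trans (rV_coord_le _ 2).
  rewrite !mxE /=; by rewrite ler_piMr// ge_min lexx.
Unshelve. all: by end_near.
Qed.

(** On the singular axis [f_C] is [(0, v) -> (0, 0, v)], so the singular curve is mapped without
    slowing down. *)
Lemma f_C_expansive_axis (x y : 'rV[R]_2) : x 0 0 = 0 -> y 0 0 = 0 ->
  `|y - x| <= `|f_C y - f_C x|.
Proof.
move=> x0 y0; apply: rV_norm_le => // i.
have [->|->] : i = 0 \/ i = 1.
  by case: i => -[|[|//]] H; [left|right]; apply: val_inj.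
- by rewrite !mxE x0 y0 subrr normr0.
- by apply: le_trans (rV_coord_le _ 2); rewrite !mxE.
Qed.

(** [G' = 0] at [t0], phrased as [G t - G t0 = o(t - t0)] so that it combines directly with
    Lipschitz bounds. *)
Definition stationary_at n (G : R -> 'rV[R]_n) (t0 : R) :=
  forall eps : R, 0 < eps -> \forall t \near t0, `|G t - G t0| <= eps * `|t - t0|.

Lemma derive0_stationary n (G : R -> 'rV[R]_n) (t0 : R) :
  (forall i, is_derive t0 (1 : R) (fun t => G t 0 i) 0) -> stationary_at G t0.
Proof.
move=> dG eps e0.
have H : \forall t \near t0, forall i, `|G t 0 i - G t0 0 i| <= eps * `|t - t0|.
  near=> t; near: t; apply: filter_forall => i.
  have /is_derive1_caratheodory[g [gE cg g0]] := dG i.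
  have : \forall t \near t0, `|g t| <= eps.
    by apply: (cvgr_norm_le _ cg) => /=; rewrite g0 normr0.
  by apply: filterS => t gt; rewrite gE normrM ler_wpM2r.
apply: filterS H => t H; apply: rV_norm_le => [|i]; first by rewrite mulr_ge0// ltW.
by rewrite !mxE.
Unshelve. all: by end_near.
Qed.

Lemma stationary_continuous n (G : R -> 'rV[R]_n) (t0 : R) :
  stationary_at G t0 -> {for t0, continuous G}.
Proof.
move=> sG; apply/cvgrPdist_le => eps e0.
near=> t; rewrite distrC; apply: (@le_trans _ _ (1 * `|t - t0|)).
  by near: t; exact: (sG 1).
rewrite mul1r distrC ltW//; near: t.
Unshelve. all: by end_near.
Qed.

Lemma derivable_coord_continuous n (G : R -> 'rV[R]_n) (t0 : R) :
  (forall i, derivable (fun t => G t 0 i) t0 1) -> {for t0, continuous G}.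
Proof.
move=> dG; apply/differentiable_continuous/derivable1_diffP/derivable_mxP => i j.
by rewrite ord1; exact: dG.
Qed.

(* Calmness of phi at x and of Phi at F (phi x) turns the lower bound for f_C into
   |t - t0| <= C |F (y t) - F (y t0)| = o(t - t0). *)
Lemma chart_no_stationary_curve (F : 'rV[R]_2 -> 'rV[R]_3) (U V : set 'rV[R]_2) (W : set 'rV[R]_3)
    phi psi Phi (x : 'rV[R]_2) (y : R -> 'rV[R]_2) (t0 k : R) :
  smooth_on U phi -> smooth_on V psi -> smooth_on W Phi ->
  (forall z, U z -> V (phi z) /\ psi (phi z) = z) ->
  (forall z, V z -> U (psi z) /\ phi (psi z) = z) ->
  (forall z, U z -> W (F (phi z)) /\ Phi (F (phi z)) = f_C z) ->
  U x -> y t0 = phi x -> {for t0, continuous y} ->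
  (forall t, `|t - t0| <= `|y t - y t0|) -> stationary_at (F \o y) t0 ->
  0 < k ->
  (\forall t \near t0, k * `|psi (y t) - x| <= `|f_C (psi (y t)) - f_C x|) -> False.
Proof.
move=> sphi spsi sPhi UV VU FC Ux yx cy ly sF k0 low.
have [Vx psix] := UV _ Ux; have [Wx Phix] := FC _ Ux.
have [L1 L10 calm1] := smooth_on_calm sphi Ux.
have [L2 L20 calm2] := smooth_on_calm sPhi Wx.
have cpsi : (psi \o y) t @[t --> t0] --> x.
  rewrite -psix -yx; apply: (cvg_comp _ _ cy).
  by rewrite yx; exact: (spsi.2 [::] _ Vx).1.
have cF : (F \o y) t @[t --> t0] --> F (phi x).
  by have := stationary_continuous sF; rewrite /prop_for/continuous_at /= yx.
(* Chosen so that [L1 * L2 * eps = k / 2], half of what the lower bound allows. *)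
pose eps := k / (2 * L1 * L2).
have eps0 : 0 < eps by rewrite divr_gt0// !mulr_gt0.
have nV : nbhs (y t0) V.
  by rewrite yx; apply: open_nbhs_nbhs; split => //; exact: spsi.1.
have : \forall t \near t0, `|t - t0| <= 2^-1 * `|t - t0|.
  near=> t.
  have Vt : V (y t).
    by near: t; exact: (cy _ nV).
  have [Ut phit] := VU _ Vt; have [_ Phit] := FC _ Ut.
  have h1 := ly t.
  have h2 : `|y t - y t0| <= L1 * `|psi (y t) - x|.
    by rewrite -{1}phit yx; near: t; exact: (cpsi _ calm1).
  have h3 : k * `|psi (y t) - x| <= `|f_C (psi (y t)) - f_C x| by near: t.
  have h4 : `|f_C (psi (y t)) - f_C x| <= L2 * `|F (y t) - F (y t0)|.
    rewrite -Phit -Phix phit yx; near: t; exact: (cF _ calm2).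
  have h5 : `|F (y t) - F (y t0)| <= eps * `|t - t0| by near: t; exact: sF.
  have h6 : k * `|t - t0| <= L1 * (L2 * (eps * `|t - t0|)).
    apply: (@le_trans _ _ (L1 * (k * `|psi (y t) - x|))).
      by rewrite mulrCA ler_pM2l// (le_trans h1).
    rewrite ler_pM2l// (le_trans h3)// (le_trans h4)//.
    by rewrite ler_pM2l.
  rewrite -(ler_pM2l k0); apply: le_trans h6 _.
  rewrite le_eqVlt; apply/orP; left; apply/eqP; rewrite /eps; field.
  by rewrite !gt_eqF.
(* The halving estimate fails at any [t] other than [t0], here [t0 + r / 2]. *)
move/nbhs_normP => [r /= r0 /(_ (t0 + r / 2))] /=.
have r2 : 0 < r / 2 by rewrite divr_gt0.
rewrite opprD addrA subrr sub0r normrN addrAC subrr add0r (gtr0_norm r2).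
have rr : r / 2 < r by clear -r0; lra.
by move=> /(_ rr) H; clear -H r2; lra.
Unshelve. all: by end_near.
Qed.

End Cuspidal.

(** * Singular points of the asymptotic completion *)

Section Completion.
Variable R : realType.

Lemma derive_along_line (V W : normedModType R) (f : V -> W) p v :
  'D_v f p = 'D_1 (fun t : R => f (p + t *: v)) 0.
Proof.
have E : (fun h : R => h^-1 *: ((f \o shift p) (h *: v) - f p))
   = (fun h => h^-1 *:
      (((fun t : R => f (p + t *: v)) \o shift 0) (h *: (1 : R)) - f (p + 0 *: v))).
  apply/funext => h /=.
  by rewrite [h *: (1 : R)]mulr1 scale0r !addr0 (addrC p).
by rewrite /derive E.
Qed.

Lemma derive_rV n (G : R -> 'rV[R]_n) (a : 'rV[R]_n) (t : R) :
  (forall i, is_derive t (1 : R) (fun s => G s 0 i) (a 0 i)) -> 'D_1 G t = a.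
Proof.
move=> dG; rewrite derive_mx.
  by apply/rowP => i; rewrite mxE; exact: (@derive_val _ _ _ _ _ _ _ (dG i)).
by apply/derivable_mxP => i j; rewrite ord1; exact: (@ex_derive _ _ _ _ _ _ _ (dG j)).
Qed.

Variables (gamma xi : R -> 'rV[R]_3) (beta c : R -> R).
Let F := a_completion gamma xi.
Let D t := beta t *: xi t.
Hypotheses (sg : smooth gamma) (sx : smooth xi)
  (beta0 : forall s, 0 < beta s) (ckb : forall k, ck k beta) (ckc : forall k, ck k c)
  (dD : forall s i, is_derive s (1 : R) (fun t => D t 0 i)
       (derive1 c s * dcurve gamma s 0 i)).

Let dg s i : is_derive s (1 : R) (fun t => gamma t 0 i) (dcurve gamma s 0 i).
Proof. by rewrite (dcurveE s i sg); exact: (ck_is_derive s (smooth_ck 1 i sg)). Qed.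

Let dx s i : is_derive s (1 : R) (fun t => xi t 0 i) (dcurve xi s 0 i).
Proof. by rewrite (dcurveE s i sx); exact: (ck_is_derive s (smooth_ck 1 i sx)). Qed.

Lemma a_completion_row0 s u :
  'D_(delta_mx 0 0 : 'rV[R]_2) F (vec2 s u) = dcurve gamma s + u *: dcurve xi s.
Proof.
rewrite derive_along_line; apply: derive_rV => i.
rewrite (_ : (fun t => _) = (fun t => gamma t 0 i + u * xi t 0 i) \o shift s).
  have D1 := is_deriveD (dg s i) (is_deriveM1 (is_derive_cst u s (1 : R)) (dx s i)).
  have D2 : is_derive (shift s 0) (1 : R) (fun t => gamma t 0 i + u * xi t 0 i)
      ((dcurve gamma s + u *: dcurve xi s) 0 i).
    by rewrite /= add0r; apply: (is_derive_eq D1); rewrite !mxE mul0r add0r.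
  by have := @is_derive1_comp _ _ (shift s) 0 _ _ D2 (is_derive_shift 0 (1 : R) s); rewrite mulr1.
apply/funext => t; rewrite /F /a_completion !mxE /= !mulr1 mulr0 addr0.
by rewrite [t + s]addrC.
Qed.

Lemma a_completion_row1 s u :
  'D_(delta_mx 0 1 : 'rV[R]_2) F (vec2 s u) = xi s.
Proof.
rewrite derive_along_line; apply: derive_rV => i.
rewrite (_ : (fun t => _) = (fun t => gamma s 0 i + (u + t) * xi s 0 i)).
  have D1 := is_deriveD (is_derive_cst (gamma s 0 i) (0 : R) (1 : R))
    (is_deriveM1 (is_deriveD (is_derive_cst u (0 : R) (1 : R)) (is_derive_id (0 : R) (1 : R)))
      (is_derive_cst (xi s 0 i) (0 : R) (1 : R))).
  by apply: (is_derive_eq D1); rewrite mulr0 addr0 !add0r mul1r.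
by apply/funext => t; rewrite /F /a_completion !mxE /= !mulr1 mulr0 addr0.
Qed.

Lemma a_completion_singular s : derive1 c s != 0 ->
  singular_point F (vec2 s (- beta s / derive1 c s)).
Proof.
move=> c0; rewrite /singular_point ltn_neqAle rank_leq_row andbT.
apply/negP => rf; have {}rf : row_free (jacobi F (vec2 s (- beta s / derive1 c s))) by [].
set J := jacobi _ _ in rf.
(* This row vector is in the left kernel: the combination of rows is [e - (beta xi' + beta' xi) / c'
   = e - D' / c' = 0]. *)
have : vec2 1 (- (derive1 beta s / derive1 c s)) *m J = 0.
  apply/rowP => i; rewrite mxE !big_ord_recl big_ord0 !mxE /= addr0.
  rewrite (_ : lift ord0 ord0 = 1); last exact: val_inj.
  rewrite (_ : ord0 = 0 :> 'I_2); last exact: val_inj.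
  rewrite a_completion_row0 a_completion_row1 !mxE.
  have E := is_derive_derive1 (dD s i).
  have Db := is_deriveM1 (ck_is_derive s (ckb 1%N)) (dx s i).
  rewrite (_ : (fun t => D t 0 i) = (fun t => beta t * xi t 0 i)) in E; last first.
    by apply/funext => t; rewrite mxE.
  rewrite (is_derive_derive1 Db) in E.
  apply: (mulfI c0); rewrite mulr0 mulrDr mul1r mulrDr -E; field.
  exact: c0.
move/(canRL (mulmxKp rf)); rewrite mul0mx => /rowP/(_ 0); rewrite !mxE /= => /eqP.
by rewrite oner_eq0.
Qed.

(** Along the singular curve [F] is [gamma - D / c']; since [c''] vanishes at [s], its derivative
    there is [e - D' / c' = 0]. *)
Lemma singular_curve_stationary s : derive1 c s != 0 -> is_derive s (1 : R) (derive1 c) 0 ->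
  stationary_at (F \o (fun t => vec2 t (- beta t / derive1 c t))) s.
Proof.
move=> c0 dc; apply: derive0_stationary => i.
rewrite (_ : (fun t => _) = (fun t => gamma t 0 i + (-1) * ((derive1 c t)^-1 * D t 0 i))); last first.
  by apply/funext => t; rewrite /F /a_completion !mxE /=; ring.
have D1 := is_deriveD (dg s i) (is_deriveM1 (is_derive_cst (-1 : R) s (1 : R))
   (is_deriveM1 (@is_deriveV _ (derive1 c) s 0 1 c0 dc) (dD s i))).
by apply: (is_derive_eq D1); rewrite scaler0 !mul0r !add0r mulN1r mulKf// subrr.
Qed.

(** With the denominator frozen at [c' s], the curve crosses the singular point in the null
    direction of the differential of [F], whatever the value of [c'']. *)
Lemma ruling_curve_stationary s : derive1 c s != 0 ->
  stationary_at (F \o (fun t => vec2 t (- beta t / derive1 c s))) s.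
Proof.
move=> c0; apply: derive0_stationary => i.
rewrite (_ : (fun t => _) = (fun t => gamma t 0 i + (- (derive1 c s)^-1) * D t 0 i)); last first.
  by apply/funext => t; rewrite /F /a_completion !mxE /=; ring.
have D1 := is_deriveD (dg s i)
  (is_deriveM1 (is_derive_cst (- (derive1 c s)^-1) s (1 : R)) (dD s i)).
by apply: (is_derive_eq D1); rewrite mul0r add0r mulNr mulKf// subrr.
Qed.

Lemma vec2_speed (h : R -> R) s t : `|t - s| <= `|vec2 t (h t) - vec2 s (h s)|.
Proof. by apply: le_trans (rV_coord_le _ 0); rewrite !mxE. Qed.

Lemma vec2_continuous (h : R -> R) s : derivable h s 1 ->
  {for s, continuous (fun t => vec2 t (h t))}.
Proof.
move=> dh; apply: derivable_coord_continuous => i.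
have [->|->] : i = 0 \/ i = 1.
  by case: i => -[|[|//]] H; [left|right]; apply: val_inj.
- rewrite (_ : (fun t => _) = id); first exact: derivable_id.
  by apply/funext => t; rewrite mxE.
- rewrite (_ : (fun t => _) = h)//.
  by apply/funext => t; rewrite mxE.
Qed.

(** A chart to [f_C] must carry the singular curve [q] into the axis [u = 0], where [f_C] is
    expansive, whereas [F] is stationary along [q] at [s]. *)
Lemma a_completion_not_cuspidal s : derive1 c s != 0 -> is_derive s (1 : R) (derive1 c) 0 ->
  ~ cuspidal_edge_at F (vec2 s (- beta s / derive1 c s)).
Proof.
move=> c0 dc [U [V [W [W' [phi [Phi]]]]]].
move=> [[sphi [oV [psi [spsi [UV VU]]]]] [U0 [phi0 [[sPhi _] [_ [Phi0 FC]]]]]].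
pose q t := vec2 t (- beta t / derive1 c t).
have cq : {for s, continuous q}.
  apply: vec2_continuous.
  have D1 := is_deriveM1 (is_deriveN (ck_is_derive s (ckb 1%N)))
    (@is_deriveV _ (derive1 c) s 0 1 c0 dc).
  exact: (@ex_derive _ _ _ _ _ _ _ D1).
have cc : continuous (derive1 c) by exact: (derivable_continuous (ckc 2).2.1).
have on_axis : \forall t \near s, (psi (q t)) 0 0 = 0.
  have nV : nbhs (q s) V.
    by apply: open_nbhs_nbhs; split => //; rewrite /q -phi0; exact: (UV _ U0).1.
  near=> t.
  have Vt : V (q t) by near: t; exact: (cq _ nV).
  have ct : derive1 c t != 0 by near: t; exact: (cvgr_neq0 _ (cc s)).
  have [Ut phit] := VU _ Vt.
  apply/eqP/negPn/negP => x0.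
  have [k k0 low] := f_C_expansive x0.
  (* If [psi (q t)] were off the axis, [f_C] would be expansive there, against the null-direction
     curve [y] through [q t]. *)
  pose y r := vec2 r (- beta r / derive1 c t).
  have cy : {for t, continuous y}.
    apply: vec2_continuous.
    have D1 := is_deriveM1 (is_deriveN (ck_is_derive t (ckb 1%N)))
      (is_derive_cst ((derive1 c t)^-1) t (1 : R)).
    exact: (@ex_derive _ _ _ _ _ _ _ D1).
  apply: (@chart_no_stationary_curve _ F U V W phi psi Phi (psi (q t)) y t k) => //.
  - exact: (vec2_speed (fun r => - beta r / derive1 c t)).
  - exact: ruling_curve_stationary.
  - have cpsi : (psi \o y) r @[r --> t] --> psi (q t).
      by apply: (cvg_comp _ _ cy); exact: (spsi.2 [::] _ Vt).1.
    exact: (cpsi _ low).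
apply: (@chart_no_stationary_curve _ F U V W phi psi Phi 0 q s 1) => //.
- exact: (vec2_speed (fun r => - beta r / derive1 c r)).
- exact: singular_curve_stationary.
- by apply: filterS on_axis => t Ht; rewrite mul1r; apply: f_C_expansive_axis; rewrite ?mxE.
Unshelve. all: by end_near.
Qed.

End Completion.

(** * Three inequivalent points on the strip *)

Lemma moebius_equiv_close (R : realType) (l : R) (p q : 'rV[R]_2) :
  0 < l -> p 0 0 < q 0 0 -> q 0 0 < p 0 0 + l -> ~ moebius_equiv l p q.
Proof.
move=> l0 pq qp [k [E _]]; move: pq qp; rewrite E ltrDl ltrD2l.
rewrite (pmulr_lgt0 _ l0) gtr_pMl// ltr0z ltrz1.
by lia.
Qed.

Theorem mainTheorem2 (R : realType) (l : R) (gamma xi : R -> 'rV[R]_3) :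
  rectifying_moebius l gamma xi ->
  exists p1 p2 p3 : 'rV[R]_2,
    [/\ ~ moebius_equiv l p1 p2, ~ moebius_equiv l p1 p3 & ~ moebius_equiv l p2 p3] /\
    (forall p, p \in [:: p1; p2; p3] ->
       singular_point (a_completion gamma xi) p /\
       ~ cuspidal_edge_at (a_completion gamma xi) p).
Proof.
move=> H; have [beta [c [[beta0 ckb ckc pb pc] [DD dD]]]] := rectifying_frame H.
have [[[l0 [sg [sx [_ [_ [px _]]]]]] _] [unit _]] := H.
have pD s : beta (s + l) *: xi (s + l) = - (beta s *: xi s) by rewrite pb px scalerN.
have dc s : is_derive s (1 : R) c (derive1 c s) := ck_is_derive s (ckc 1%N).
have pdc s : derive1 c (s + l) = - derive1 c s.
  have D1 := @is_derive1_comp _ _ (shift l) s _ _ (dc (s + l)) (is_derive_shift s (1 : R) l).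
  rewrite (_ : _ \o _ = - c) ?mulr1 in D1; last by apply/funext => t /=; rewrite pc.
  by rewrite -(is_derive_derive1 D1) (is_derive_derive1 (is_deriveN (dc s))).
(* Applied to [c']: the points found are zeros of [c''] at which [c'] is nonzero. *)
have [s1 [s2 [s3 [[s12 s23 s31] crit]]]] := antiperiodic_three_critical l0 (ckc 2).2.1 pdc
  (antiperiodic_ruling_neg l0 (ckc 1%N).1 unit DD dD pD pc).
pose p s := vec2 s (- beta s / derive1 c s).
have p0 s : p s 0 0 = s by rewrite mxE.
exists (p s1), (p s2), (p s3); split.
  (* The three parameters lie within less than one period of each other. *)
  by split; apply: moebius_equiv_close => //; rewrite !p0; lra.
have good s : s \in [:: s1; s2; s3] -> singular_point (a_completion gamma xi) (p s) /\
       ~ cuspidal_edge_at (a_completion gamma xi) (p s).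
  move=> /crit[c0 c1]; split.
    exact: a_completion_singular.
  exact: a_completion_not_cuspidal.
move=> _ /(@mapP _ _ p [:: s1; s2; s3])[s ss ->]; exact: good.
Qed.
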